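(* Consider a spherical 4-bar linkage with sector angles satisfying $\alpha=\pi-\beta=\pi-\gamma=\delta\neq\pi/2$ (type ''Miura I''). (i) Finite solutions. There are two branches of flexes, each diffeomorphic to a circle $S^1$, with the parametrizations $$x=0,\ y\in\mathbb{R}\cup\{\infty\},\ z=0,\ w=y\qquad\text{or}\qquad x\in\mathbb{R}\cup\{\infty\},\ y=x\cos\alpha,\ z=x,\ w=-x\cos\alpha.$$ (ii) Solutions at infinity. The solutions at infinity form another branch, diffeomorphic to a circle $S^1$: $$x\in\mathbb{R}\cup\{\infty\},\quad y\equiv\infty,\quad z=-x,\quad w\equiv\infty.$$
   Context: A spherical 4-bar linkage (equivalently, a degree-4 single-vertex rigid origami) is a closed chain of four great-circle arcs on the unit sphere with lengths (sector angles), in counter-clockwise cyclic order, $\alpha,\beta,\gamma,\delta\in(0,\pi)$. Its configuration is described by the folding angles (signed turning angles between consecutive arcs) $\rho_x,\rho_y,\rho_z,\rho_w\in\mathbb{R}/2\pi$, where $\rho_x$ is at the joint of $\alpha$ and $\beta$, $\rho_y$ of $\beta$ and $\gamma$, $\rho_z$ of $\gamma$ and $\delta$, $\rho_w$ of $\delta$ and $\alpha$. Write $x=\tan(\rho_x/2)$, $y=\tan(\rho_y/2)$, $z=\tan(\rho_z/2)$, $w=\tan(\rho_w/2)$, all in $\mathbb{R}\cup\{\infty\}$, the one-point compactification of the real line (folding angles $\pi$ and $-\pi$ are identified and correspond to $\infty$). Finite solutions are the flexes found with $x,y,z,w$ finite, each branch then being completed over $\mathbb{R}\cup\{\infty\}$;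 solutions at infinity are those with some of $x,y,z,w$ equal to $\infty$. For real $c\neq0$, $c\cdot\infty=\infty$. *)

(* Defs.v *)
From HB Require Import structures.
From mathcomp Require Import all_boot all_order all_algebra.
From mathcomp Require Import all_classical all_reals all_analysis.

Set Implicit Arguments.
Unset Strict Implicit.
Unset Printing Implicit Defensive.

Import Order.TTheory GRing.Theory Num.Theory.
Import numFieldNormedType.Exports.

Local Open Scope classical_set_scope.
Local Open Scope ring_scope.

(** A frame on the unit sphere is a matrix with columns [p, t, n]: a point [p],
    a unit tangent vector [t] at [p] (the direction of travel) and
    [n = p x t].  Moving a frame [F] along the great circle through [(p, t)] by
    an arc of length [l] gives [F *m arc_mx l]; turning it counter-clockwise
    about [p] by the angle [rho] gives [F *m turn_mx rho]. *)

Definition arc_mx (R : realType) (l : R) : 'M[R]_3 :=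
  \matrix_(i, j) nth 0 (nth [::]
    [:: [:: cos l; - sin l; 0];
        [:: sin l;   cos l; 0];
        [:: 0;       0;     1]] i) j.

Definition turn_mx (R : realType) (rho : R) : 'M[R]_3 :=
  \matrix_(i, j) nth 0 (nth [::]
    [:: [:: 1; 0;       0        ];
        [:: 0; cos rho; - sin rho];
        [:: 0; sin rho;   cos rho]] i) j.

Definition closes (R : realType) (alpha beta gamma delta rx ry rz rw : R) : Prop :=
  arc_mx alpha *m turn_mx rx *m arc_mx beta *m turn_mx ry *m
  arc_mx gamma *m turn_mx rz *m arc_mx delta *m turn_mx rw = 1%:M.

Definition extline (R : realType) : topologicalType :=
  one_point_compactification R.

Definition fin (R : realType) (t : R) : extline R := Some t.
Definition infty (R : realType) : extline R := None.
Arguments infty {R}.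

(** [c * t] with [c * infty = infty]; only meaningful for [c != 0]. *)
Definition oscale (R : realType) (c : R) (t : extline R) : extline R :=
  omap ( *%R c) t.

Definition half_tan (R : realType) (rho : R) : extline R :=
  if cos (rho / 2) == 0 then infty else fin (tan (rho / 2)).

Definition config (R : realType) : topologicalType :=
  (extline R * extline R * extline R * extline R)%type.

(** A class of folding angles modulo [2 * pi] is given by a real
    representative; [closes] and [half_tan] are [2 * pi]-periodic in it. *)
Definition solutions (R : realType) (alpha beta gamma delta : R) :
    set (config R) :=
  [set c | exists rx ry rz rw : R,
     closes alpha beta gamma delta rx ry rz rw /\
     c = (half_tan rx, half_tan ry, half_tan rz, half_tan rw)].

Definition finite_configs (R : realType) : set (config R) :=
  [set c | exists x y z w : R, c = (fin x, fin y, fin z, fin w)].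
Arguments finite_configs {R}.

Definition finite_solutions (R : realType) (alpha beta gamma delta : R) :
    set (config R) :=
  solutions alpha beta gamma delta `&` finite_configs.

Definition solutions_at_infinity (R : realType) (alpha beta gamma delta : R) :
    set (config R) :=
  solutions alpha beta gamma delta `&` ~` finite_configs.

(** [C] is the completion over the extended line of its finite part. *)
Definition completed (R : realType) (C : set (config R)) : Prop :=
  C = closure (C `&` finite_configs).

(** [f] is of class C^k on [U] (meant for [U] open and [V] of finite
    dimension). *)
Fixpoint Ck_on (R : realType) (V W : normedModType R) (k : nat)
    (U : set V) (f : V -> W) : Prop :=
  match k with
  | 0%N => forall p, U p -> {for p, continuous f}
  | k'.+1 => (forall p, U p -> differentiable f p) /\
             (forall v : V, Ck_on k' U (fun p => 'D_v f p))
  end.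

Definition smooth_on (R : realType) (V W : normedModType R)
    (U : set V) (f : V -> W) : Prop :=
  forall k, Ck_on k U f.

(** Smoothness on an arbitrary subset: [f] extends, locally around each point
    of [A], to a smooth map on an open set of the ambient space. *)
Definition smooth_on_subset (R : realType) (V W : normedModType R)
    (A : set V) (f : V -> W) : Prop :=
  forall p, A p -> exists (U : set V) (F : V -> W),
    [/\ open U, U p, smooth_on U F & {in A `&` U, f =1 F}].

Definition diffeomorphic (R : realType) (V W : normedModType R)
    (A : set V) (B : set W) : Prop :=
  exists (f : V -> W) (g : W -> V),
    [/\ smooth_on_subset A f, smooth_on_subset B g,
        (forall p, A p -> B (f p) /\ g (f p) = p) &
        (forall q, B q -> A (g q) /\ f (g q) = q)].

Definition circle (R : realType) : set (R * R)%type :=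
  [set p | p.1 ^+ 2 + p.2 ^+ 2 = 1].
Arguments circle {R}.

(** The smooth structure of the extended line is that of the unit circle under
    [tan (rho / 2) |-> (cos rho, sin rho)]; see [circle_point_half_tan].
    Accordingly the space of configurations is viewed as the torus in
    [(R^2)^4]. *)
Definition circle_point (R : realType) (t : extline R) : (R * R)%type :=
  if t is Some u then ((1 - u ^+ 2) / (1 + u ^+ 2), 2 * u / (1 + u ^+ 2))
  else (-1, 0).

Definition torus_point (R : realType) (c : config R) :
    ((R * R) * (R * R) * (R * R) * (R * R))%type :=
  let: (x, y, z, w) := c in
  (circle_point x, circle_point y, circle_point z, circle_point w).

Definition diffeomorphic_to_circle (R : realType) (C : set (config R)) : Prop :=
  diffeomorphic (@torus_point R @` C) (@circle R).

Lemma circle_point_half_tan (R : realType) (rho : R) :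
  circle_point (half_tan rho) = (cos rho, sin rho).
Proof.
have rhoE : rho = rho / 2 + rho / 2 by rewrite -splitr.
have cE : cos rho = cos (rho / 2) ^+ 2 - sin (rho / 2) ^+ 2.
  by rewrite {1}rhoE cosD !expr2.
have sE : sin rho = 2 * (sin (rho / 2) * cos (rho / 2)).
  by rewrite {1}rhoE sinD [cos _ * sin _]mulrC mulr_natl mulr2n.
have u := cos2Dsin2 (rho / 2).
rewrite /half_tan; case: eqVneq => [c0|c0] /=.
  move: u; rewrite cE sE c0 expr0n add0r mulr0 mulr0 => ->.
  by rewrite sub0r.
have tE : 1 + tan (rho / 2) ^+ 2 = (cos (rho / 2) ^+ 2)^-1.
  by rewrite /tan expr_div_n -[X in X + _](divff (expf_neq0 2 c0)) -mulrDl u mul1r.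
rewrite tE invrK cE sE /tan; congr pair.
  by rewrite expr_div_n mulrBl mul1r divfK // expf_neq0.
by rewrite -!mulrA expr2 [_^-1 * _]mulrA mulVf // mul1r.
Qed.

(* Main.v *)
Require Import Defs.
From HB Require Import structures.
From mathcomp Require Import all_boot all_order all_algebra.
From mathcomp Require Import all_classical all_reals all_analysis.
From mathcomp Require Import ring lra.

(* Writing [P = arc_mx pi] one has [arc_mx (pi - a) = P *m arc_mx (- a)] and
   [P *m turn_mx r *m P = turn_mx (- r)], so the closing condition becomes
   [T x *m M y *m T z = M w], where [T x] is the turn at [x] and
   [M y = A *m T (- y) *m A] with [A = arc_mx (- a)].  The (1,1) entries give
   [cos y = cos w].  If [y = w = pi] then [M] is itself the turn by [pi] and the
   equation says [x + z = 0].  Otherwise, in half-tangents, [w = y] or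
   [w = - y], and the first row and the first column say that the rotations by
   [- z] and [- x] both take the vector [(cos a, y)] to [(cos a, w)], which
   determines [z] and [x].

   Each branch is the image of the extended line under a continuous curve with a
   coordinate that parametrizes the circle; the other coordinates are constant
   or a scaling of the half-tangent, which is a rational map with no pole on the
   circle. *)

Set Implicit Arguments.
Unset Strict Implicit.
Unset Printing Implicit Defensive.

Import Order.TTheory GRing.Theory Num.Theory.
Import numFieldNormedType.Exports.

Local Open Scope classical_set_scope.
Local Open Scope ring_scope.

(** * Explicit 3 by 3 matrices *)

Section Mat3.
Variable R : comNzRingType.

(** The nested lists have the shape used in [arc_mx] and [turn_mx], so [arc_mxE] and [turn_mxE] hold
    by conversion. *)
Definition mat3 (a b c d e f g h k : R) : 'M[R]_3 :=
  \matrix_(i, j) nth 0 (nth [::]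
    [:: [:: a; b; c]; [:: d; e; f]; [:: g; h; k]] i) j.

Lemma mul_mat3 (a b c d e f g h k a' b' c' d' e' f' g' h' k' : R) :
  mat3 a b c d e f g h k *m mat3 a' b' c' d' e' f' g' h' k' =
  mat3 (a * a' + b * d' + c * g') (a * b' + b * e' + c * h')
       (a * c' + b * f' + c * k')
       (d * a' + e * d' + f * g') (d * b' + e * e' + f * h')
       (d * c' + e * f' + f * k')
       (g * a' + h * d' + k * g') (g * b' + h * e' + k * h')
       (g * c' + h * f' + k * k').
Proof.
apply/matrixP => i j; rewrite !mxE !big_ord_recl big_ord0 !mxE /= addr0 addrA.
by case: i => -[|[|[|//]]] ?; case: j => -[|[|[|//]]] ?.
Qed.

Lemma mat3_1 : 1%:M = mat3 1 0 0 0 1 0 0 0 1.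
Proof.
apply/matrixP => i j; rewrite !mxE.
by case: i => -[|[|[|//]]] ?; case: j => -[|[|[|//]]] ?.
Qed.

Lemma mat3P (a b c d e f g h k a' b' c' d' e' f' g' h' k' : R) :
  mat3 a b c d e f g h k = mat3 a' b' c' d' e' f' g' h' k' <->
  [/\ [/\ a = a', b = b' & c = c'], [/\ d = d', e = e' & f = f'] &
      [/\ g = g', h = h' & k = k']].
Proof.
split=> [/matrixP eqM|[[-> -> ->] [-> -> ->] [-> -> ->]] //].
pose i0 : 'I_3 := ord0; pose i1 : 'I_3 := lift ord0 ord0.
pose i2 : 'I_3 := ord_max.
have E i j := eqM i j.
by do !split; [have := E i0 i0|have := E i0 i1|have := E i0 i2
  |have := E i1 i0|have := E i1 i1|have := E i1 i2
  |have := E i2 i0|have := E i2 i1|have := E i2 i2]; rewrite !mxE.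
Qed.

End Mat3.

(** * The closing equation and its solutions in half-tangents *)

Section Linkage.
Variable R : realType.
Implicit Types (a l r rx ry rz rw : R).

Lemma arc_mxE l : arc_mx l = mat3 (cos l) (- sin l) 0 (sin l) (cos l) 0 0 0 1.
Proof. by []. Qed.

Lemma turn_mxE r : turn_mx r = mat3 1 0 0 0 (cos r) (- sin r) 0 (sin r) (cos r).
Proof. by []. Qed.

Lemma arc_mxNK l : arc_mx l *m arc_mx (- l) = 1%:M.
Proof.
have := cos2Dsin2 l => h.
rewrite !arc_mxE mul_mat3 mat3_1 cosN sinN; apply/mat3P.
by do !split; try ring; rewrite -h; ring.
Qed.

Lemma turn_mxNK r : turn_mx r *m turn_mx (- r) = 1%:M.
Proof.
have := cos2Dsin2 r => h.
rewrite !turn_mxE mul_mat3 mat3_1 cosN sinN; apply/mat3P.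
by do !split; try ring; rewrite -h; ring.
Qed.

Lemma arc_turn_arc_supplement a r :
  arc_mx (pi - a) *m turn_mx r *m arc_mx (pi - a) =
  arc_mx (- a) *m turn_mx (- r) *m arc_mx (- a).
Proof.
rewrite !arc_mxE !turn_mxE !mul_mat3 cosB sinB cospi sinpi !(cosN, sinN).
by apply/mat3P; do !split; ring.
Qed.

(** The closing product has the form [arc_mx a *m P *m arc_mx a *m turn_mx rw]. The factors around
    [P] are invertible, so they can be moved to the other side. *)
Lemma closes_miuraE a rx ry rz rw :
  closes a (pi - a) (pi - a) a rx ry rz rw <->
  turn_mx rx *m (arc_mx (- a) *m turn_mx (- ry) *m arc_mx (- a)) *m turn_mx rz =
  arc_mx (- a) *m turn_mx (- rw) *m arc_mx (- a).
Proof.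
have aK := mulmx1C (arc_mxNK a); have aK' := arc_mxNK a.
have wK := turn_mxNK rw; have wK' := mulmx1C wK.
rewrite -arc_turn_arc_supplement /closes; set P := turn_mx rx *m _ *m _.
have -> : arc_mx a *m turn_mx rx *m arc_mx (pi - a) *m turn_mx ry *m
  arc_mx (pi - a) *m turn_mx rz *m arc_mx a *m turn_mx rw =
  arc_mx a *m P *m arc_mx a *m turn_mx rw by rewrite /P !mulmxA.
clearbody P; split=> [e|->]; last first.
  by rewrite !mulmxA aK' mul1mx -(mulmxA _ (arc_mx (- a))) aK mulmx1 wK'.
have <- : arc_mx (- a) *m (arc_mx a *m P *m arc_mx a *m turn_mx rw) *m
    turn_mx (- rw) *m arc_mx (- a) = P.
  rewrite (mulmxA (arc_mx (- a))) -(mulmxA _ (turn_mx rw)) wK mulmx1.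
  by rewrite !mulmxA aK mul1mx -mulmxA aK' mulmx1.
by rewrite e mulmx1.
Qed.

(** The argument stands for [(cos r, sin r)]: with a point of the circle in place of an angle, the
    value [infty] needs no separate formula. *)
Definition turn3 (p : R * R) := mat3 1 0 0 0 p.1 (- p.2) 0 p.2 p.1.

(* The product [arc_mx (- a) *m turn_mx (- r) *m arc_mx (- a)] for
   [(c, s) = (cos a, sin a)] and [p = (cos r, sin r)]. *)
Definition vertex3 (c s : R) (p : R * R) :=
  mat3 (c ^+ 2 - s ^+ 2 * p.1) (c * s * (1 + p.1)) (s * p.2)
       (- (c * s * (1 + p.1))) (c ^+ 2 * p.1 - s ^+ 2) (c * p.2)
       (s * p.2) (- (c * p.2)) p.1.

Lemma closes_miura_circleE a rx ry rz rw :
  closes a (pi - a) (pi - a) a rx ry rz rw <->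
  turn3 (cos rx, sin rx) *m vertex3 (cos a) (sin a) (cos ry, sin ry) *m
    turn3 (cos rz, sin rz) = vertex3 (cos a) (sin a) (cos rw, sin rw).
Proof.
rewrite closes_miuraE.
have vE r : arc_mx (- a) *m turn_mx (- r) *m arc_mx (- a) =
    vertex3 (cos a) (sin a) (cos r, sin r).
  rewrite !arc_mxE !turn_mxE !mul_mat3 !(cosN, sinN).
  by apply/mat3P; do !split => /=; ring.
by rewrite !vE.
Qed.

Lemma sqrD_neq0 (c v : R) : c != 0 -> c ^+ 2 + v ^+ 2 != 0.
Proof. by move=> c0; rewrite gt_eqF // ltr_pwDl ?sqr_ge0 // exprn_even_gt0. Qed.

Lemma sqrD1_neq0 (u : R) : 1 + u ^+ 2 != 0.
Proof. by have := sqrD_neq0 u (oner_neq0 R); rewrite expr1n. Qed.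

Lemma circle_point_in_circle (x : extline R) : circle (circle_point x).
Proof.
case: x => [u|]; rewrite /circle /=; last by ring.
by field; exact: sqrD1_neq0.
Qed.

Lemma circle_point_inj : injective (@circle_point R).
Proof.
have n1 u : (1 - u ^+ 2) / (1 + u ^+ 2) <> -1 :> R.
  move=> e; have /eqP := congr1 ( *%R^~ (1 + u ^+ 2)) e.
  rewrite divfK ?sqrD1_neq0 // => /eqP h.
  suff : (1 : R) = 0 by move/eqP; rewrite oner_eq0.
  lra.
case=> [u|] [v|] //= [].
- move=> e1 e2; congr Some.
  (* The half-angle formula [tan (r / 2) = sin r / (1 + cos r)] recovers [t] from its circle
     point. *)
  have h (t : R) : t = 2 * t / (1 + t ^+ 2) / (1 + (1 - t ^+ 2) / (1 + t ^+ 2)).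
    have t0 := sqrD1_neq0 t.
    have -> : 1 + (1 - t ^+ 2) / (1 + t ^+ 2) = 2 / (1 + t ^+ 2) by field.
    by field; rewrite t0.
  by rewrite (h u) (h v) e1 e2.
- by move/n1.
- by move=> e; case: (n1 v).
Qed.

Lemma half_tan_surj (x : extline R) : exists r, half_tan r = x.
Proof.
case: x => [u|]; last first.
  by exists pi; rewrite /half_tan cos_pihalf eqxx.
exists (2 * atan u); rewrite /half_tan.
have -> : 2 * atan u / 2 = atan u by field.
by rewrite atanK gt_eqF // cos_atan invr_gt0 sqrtr_gt0 ltr_pwDl // sqr_ge0.
Qed.

(** Every extended half-tangent comes from some angle, and its circle point gives the cosine and
    sine of that angle, so the angles can be eliminated. *)
Lemma solutions_miuraE a (x y z w : extline R) :
  solutions a (pi - a) (pi - a) a (x, y, z, w) <->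
  turn3 (circle_point x) *m vertex3 (cos a) (sin a) (circle_point y) *m
    turn3 (circle_point z) = vertex3 (cos a) (sin a) (circle_point w).
Proof.
split=> [[rx [ry [rz [rw [/closes_miura_circleE h [-> -> -> ->]]]]]]|h].
  by rewrite !circle_point_half_tan.
have [[rx ex] [ry ey]] := (half_tan_surj x, half_tan_surj y).
have [[rz ez] [rw ew]] := (half_tan_surj z, half_tan_surj w).
exists rx, ry, rz, rw; rewrite ex ey ez ew; split=> //.
by apply/closes_miura_circleE; rewrite -!circle_point_half_tan ex ey ez ew.
Qed.

Lemma circle_pointN (x : extline R) :
  circle_point (oscale (-1) x) = ((circle_point x).1, - (circle_point x).2).
Proof.
have := sqrD1_neq0; case: x => [u|] /= ne0; last by rewrite oppr0.
by rewrite mulN1r sqrrN mulrN mulNr.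
Qed.

(* The two equations say that the rotation by minus the angle of [p] takes
   [(c, v)] to [(c, u)]. *)
Lemma rotation_unique (c v u : R) (p : R * R) : c != 0 ->
  c * p.1 + v * p.2 = c -> v * p.1 - c * p.2 = u ->
  p = ((c ^+ 2 + u * v) / (c ^+ 2 + v ^+ 2), c * (v - u) / (c ^+ 2 + v ^+ 2)).
Proof.
move=> c0; case: p => X S /= h1 h2.
have d0 := sqrD_neq0 v c0.
have e1 : c ^+ 2 + u * v = X * (c ^+ 2 + v ^+ 2).
  by rewrite -h2 expr2 -[X in _ * X + _]h1; ring.
have e2 : c * (v - u) = S * (c ^+ 2 + v ^+ 2).
  by rewrite mulrBr [c * v]mulrC -[X in v * X]h1 -h2; ring.
by rewrite e1 e2 !mulfK.
Qed.

(** The right-hand side is the value given by [rotation_unique] for [u = - v]; this identifies the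
    half-tangent of that rotation as [v / c]. *)
Lemma circle_point_fin_div (c v : R) : c != 0 ->
  circle_point (fin (v / c)) =
  ((c ^+ 2 - v ^+ 2) / (c ^+ 2 + v ^+ 2), 2 * c * v / (c ^+ 2 + v ^+ 2)).
Proof.
move=> c0; have d0 := sqrD_neq0 v c0.
have e : 1 + (v / c) ^+ 2 = (c ^+ 2 + v ^+ 2) / c ^+ 2 by field.
by rewrite /circle_point /fin e; congr pair; field; rewrite c0 d0.
Qed.

Lemma circle_point_fin0 : circle_point (fin 0) = (1, 0) :> R * R.
Proof.
by rewrite /circle_point /fin expr0n /= subr0 addr0 divr1 mulr0 mul0r.
Qed.

Lemma circle_point_eqN1 (x : extline R) : (circle_point x).1 = -1 -> x = infty.
Proof.
move=> h; apply: circle_point_inj; have := circle_point_in_circle x.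
rewrite /circle /= h sqrrN expr1n => /(canRL (addKr _)).
rewrite addNr => /eqP; rewrite sqrf_eq0 => /eqP h2.
by rewrite [LHS]surjective_pairing h h2.
Qed.

Lemma vertex3_solutions (c s : R) (x y z w : extline R) : c ^+ 2 + s ^+ 2 = 1 ->
  c != 0 -> s != 0 ->
  turn3 (circle_point x) *m vertex3 c s (circle_point y) *m
    turn3 (circle_point z) = vertex3 c s (circle_point w) ->
  [\/ [/\ x = fin 0, z = fin 0 & w = y],
      [/\ y = oscale c x, z = x & w = oscale (- c) x] |
      [/\ y = infty, z = oscale (-1) x & w = infty]].
Proof.
move=> cs c0 s0; rewrite /turn3 /vertex3 !mul_mat3.
case/mat3P => -[e11 e12 e13] [e21 _ _] [e31 e32 e33].
(* The outer turns fix the first basis vector, so the (1,1) entry only compares the two vertex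
   matrices; [s != 0] then isolates the cosines. *)
have {}e11 : (circle_point y).1 = (circle_point w).1.
  apply: (mulfI (expf_neq0 2 s0)); apply: oppr_inj; apply: (addrI (c ^+ 2)).
  by rewrite -e11; ring.
case: y e11 e12 e13 e21 e31 e32 e33 => [v|] /= e11; last first.
  have -> : w = infty by exact/circle_point_eqN1.
  rewrite /= => _ _ _ _ e32 e33; apply: Or33; split=> //.
  apply: circle_point_inj; rewrite circle_pointN.
  have := circle_point_in_circle x; rewrite /circle /=.
  move: (circle_point x) (circle_point z) e32 e33 => [X S] [Z T] /= e32 e33 u.
  have {}cs : s ^+ 2 = 1 - c ^+ 2 by rewrite -cs addrC addKr.
  (* The (3,2) and (3,3) entries say that the angles of [x] and [z] add up to an angle with sine 0
     and cosine 1. Below, [e1] and [e2] are the subtraction formulas that recover [z] from this sum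
     and [x]. *)
  have {}e32 : T * X = - (S * Z).
    suff : - (S * Z) - X * T = - (c * 0) by rewrite mulr0; lra.
    rewrite -e32; ring: cs.
  have {}e33 : X * Z = 1 + S * T.
    rewrite -[1]opprK -e33; ring: cs.
  have e1 : Z = X * (X * Z - S * T) + S * (T * X + S * Z).
    by rewrite -[LHS]mul1r -u; ring.
  have e2 : T = X * (T * X + S * Z) - S * (X * Z - S * T).
    by rewrite -[LHS]mul1r -u; ring.
  congr pair; [rewrite e1|rewrite e2]; rewrite e32 e33; ring.
case: w e11 => [u|] /=; last first.
  by move=> h; have := @circle_point_eqN1 (Some v) h.
move=> e11 e12 e13 e21 e31 _ _.
have v0 := sqrD1_neq0 v; have u0 := sqrD1_neq0 u.
have e1D (t : R) : 1 + t ^+ 2 != 0 ->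
    1 + (1 - t ^+ 2) / (1 + t ^+ 2) = 2 / (1 + t ^+ 2).
  by move=> ?; field.
have uv : 1 + u ^+ 2 = 1 + v ^+ 2.
  have := congr1 (+%R 1) e11; rewrite !e1D // => /(mulfI _) h.
  by apply: invr_inj; rewrite h ?pnatr_eq0.
rewrite (addrI _ uv) in e12 e13 e21 e31.
(* This is a common factor of the four remaining equations, because [1 + cos y = 2 / (1 + v ^+ 2)]
   and [sin y = 2 * v / (1 + v ^+ 2)]. Cancelling it leaves the linear systems of
   [rotation_unique]. *)
have d0 : 2 * s / (1 + v ^+ 2) != 0 by rewrite !mulf_neq0 ?invr_eq0 ?pnatr_eq0.
have z1 : c * (circle_point z).1 + v * (circle_point z).2 = c.
  apply: (mulfI d0); transitivity (c * s * (1 + (1 - v ^+ 2) / (1 + v ^+ 2))).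
    by rewrite -e12; field.
  by field.
have z2 : v * (circle_point z).1 - c * (circle_point z).2 = u.
  apply: (mulfI d0); transitivity (s * (2 * u / (1 + v ^+ 2))); last by field.
  by rewrite -e13; field.
have x1 : c * (circle_point x).1 + v * (circle_point x).2 = c.
  apply: (mulfI d0); transitivity (c * s * (1 + (1 - v ^+ 2) / (1 + v ^+ 2))).
    by rewrite -[LHS]opprK; apply: oppr_inj; rewrite -e21; field.
  by field.
have x2 : v * (circle_point x).1 - c * (circle_point x).2 = u.
  apply: (mulfI d0); transitivity (s * (2 * u / (1 + v ^+ 2))); last by field.
  by rewrite -e31; field.
have zE := rotation_unique c0 z1 z2; have xE := rotation_unique c0 x1 x2.
have zx : z = x by apply: circle_point_inj; rewrite zE xE.
have cv0 := sqrD_neq0 v c0.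
(* For [u = v] the rotation is the identity, which gives [x = 0]; for [u = - v] its half-tangent is
   [v / c], so [y] and [w] are the multiples of [x] by [c] and [- c]. *)
have /eqP := addrI _ uv; rewrite eqf_sqr => /orP[] /eqP euv.
  apply: Or31; rewrite zx; suff -> : x = fin 0 by rewrite euv.
  apply: circle_point_inj; rewrite xE circle_point_fin0 euv.
  by rewrite -expr2 divff // subrr mulr0 mul0r.
apply: Or32; rewrite zx; suff -> : x = fin (v / c).
  by split=> //=; congr Some; rewrite ?euv; field.
apply: circle_point_inj; rewrite xE circle_point_fin_div // euv.
by congr pair; field.
Qed.

(** Together with the next two lemmas this is the converse of [vertex3_solutions]. Here both outer
    turns are the identity. *)
Lemma vertex3_flat (c s : R) (y : extline R) :
  turn3 (circle_point (fin 0)) *m vertex3 c s (circle_point y) *m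
    turn3 (circle_point (fin 0)) = vertex3 c s (circle_point y).
Proof.
rewrite circle_point_fin0 /turn3 /vertex3 !mul_mat3.
by apply/mat3P; do !split => /=; ring.
Qed.

Lemma vertex3_folded (c s : R) (x : extline R) : c ^+ 2 + s ^+ 2 = 1 ->
  turn3 (circle_point x) *m vertex3 c s (circle_point (oscale c x)) *m
    turn3 (circle_point x) = vertex3 c s (circle_point (oscale (- c) x)).
Proof.
move=> cs; have {}cs : s ^+ 2 = 1 - c ^+ 2 by rewrite -cs addrC addKr.
rewrite /turn3 /vertex3 !mul_mat3; case: x => [u|] /=; last first.
  by apply/mat3P; do !split; ring: cs.
have u0 := sqrD1_neq0 u; have cu0 := sqrD1_neq0 (c * u).
rewrite [- c * u]mulNr [(- (c * u)) ^+ 2]sqrrN.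
by apply/mat3P; do !split; field: cs; rewrite ?u0 ?cu0.
Qed.

Lemma vertex3_infty (c s : R) (x : extline R) : c ^+ 2 + s ^+ 2 = 1 ->
  turn3 (circle_point x) *m vertex3 c s (circle_point infty) *m
    turn3 (circle_point (oscale (-1) x)) = vertex3 c s (circle_point infty).
Proof.
move=> cs; have {}cs : s ^+ 2 = 1 - c ^+ 2 by rewrite -cs addrC addKr.
rewrite circle_pointN /turn3 /vertex3 !mul_mat3.
have := circle_point_in_circle x; rewrite /circle /=.
move: (circle_point x) => [X S] /= /(canRL (addKr _)) XS.
by apply/mat3P; do !split; ring: cs XS.
Qed.

End Linkage.

(** * Closure properties of maps of class C^k *)

Section Smooth.
Variables (R : realType) (V : normedModType R).
Implicit Types (U : set V) (W : normedModType R) (k : nat).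

Lemma Ck_on_continuous W k U (f : V -> W) :
  Ck_on k U f -> forall p, U p -> {for p, continuous f}.
Proof.
case: k => [//|k] [df _] p Up; exact/differentiable_continuous/df.
Qed.

Lemma Ck_onS W k U (f : V -> W) : Ck_on k.+1 U f -> Ck_on k U f.
Proof.
elim: k f => [|k IH] f; first exact: Ck_on_continuous.
by move=> [df Df]; split=> // v; exact: IH.
Qed.

Lemma derive_near_eq W U (f g : V -> W) p (v : V) : open U -> U p ->
  {in U, f =1 g} -> 'D_v f p = 'D_v g p.
Proof.
move=> oU Up fg; apply: near_eq_derive.
by near=> q; apply: fg; apply/mem_set; near: q; exact: open_nbhs_nbhs.
Unshelve. all: by end_near. Qed.

(** The first-order expansion of [f] at [p] is also one of [g], and uniqueness of the linear part
    makes it the differential of [g]. *)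
Lemma near_eq_differentiable W (f g : V -> W) p :
  {near p, f =1 g} -> differentiable f p -> differentiable g p.
Proof.
move=> fg /diff_locallyP[cf ff].
have gf : g \o shift p = cst (g p) + 'd f p +o_ 0 id.
  have fgp := nbhs_singleton fg.
  move/eqaddoP: ff => ff; apply/eqaddoP => e e0; have := ff e e0.
  apply: filter_app.
  have : \forall y \near 0, f (y + p) = g (y + p).
    by have := fg; rewrite (near_shift 0) /= subr0.
  by apply: filterS => y /= fgy; rewrite !fctE /= fgy fgp.
by apply/diff_locallyP; rewrite (diff_unique cf gf).
Qed.

(** Needed because the differentiation rules below give formulas for derivatives at points of [U]
    only. *)
Lemma eq_Ck_on W k U (f g : V -> W) : open U ->
  {in U, f =1 g} -> Ck_on k U f -> Ck_on k U g.
Proof.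
move=> oU; elim: k f g => [|k IH] f g fg /=.
  move=> cf p Up; have Uf : f p = g p by apply/fg/mem_set.
  rewrite /prop_for /continuous_at -Uf; apply: cvg_trans (cf p Up).
  apply: near_eq_cvg; near=> q; apply: fg; apply/mem_set; near: q.
  exact: open_nbhs_nbhs.
move=> [df Df]; split=> [p Up|v].
  apply: near_eq_differentiable (df p Up).
  near=> q; apply: fg; apply/mem_set; near: q; exact: open_nbhs_nbhs.
apply: IH (Df v) => p /set_mem Up; exact: derive_near_eq Up fg.
Unshelve. all: by end_near. Qed.

Lemma Ck_on_cst W k U (a : W) : Ck_on k U (cst a).
Proof.
elim: k a => [|k IH] a /=; first by move=> p _; exact: cvg_cst.
split=> [p _|v]; first exact: differentiable_cst.
have -> : (fun p => 'D_v (cst a) p) = cst 0.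
  by apply/funext => p; rewrite derive_cst.
exact: IH.
Qed.

Lemma Ck_on_linear W k U (f : {linear V -> W}) : continuous f -> Ck_on k U f.
Proof.
move=> cf; case: k => [|k] /=; first by move=> p _; exact: cf.
split=> [p _|v]; first exact: linear_differentiable.
have -> : (fun p => 'D_v f p) = cst (f v).
  by apply/funext => p; rewrite deriveE ?diff_lin //;
    exact: linear_differentiable.
exact: Ck_on_cst.
Qed.

Lemma Ck_on_pair (W W' : normedModType R) k U (f : V -> W) (g : V -> W') :
  open U ->
  Ck_on k U f -> Ck_on k U g -> Ck_on k U (fun p => (f p, g p)).
Proof.
move=> oU; elim: k f g => [|k IH] f g /=.
  by move=> cf cg p Up; apply: cvg_pair; [exact: cf|exact: cg].
move=> [df Df] [dg Dg]; split=> [p Up|v].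
  by apply: differentiable_pair; [exact: df|exact: dg].
apply: (@eq_Ck_on _ _ _ (fun p => ('D_v f p, 'D_v g p))); [by []| |exact: IH].
move=> p /set_mem Up; have [dfp dgp] := (df p Up, dg p Up).
by rewrite !deriveE ?diff_pair //; exact: differentiable_pair.
Qed.

Lemma Ck_onD W k U (f g : V -> W) : open U ->
  Ck_on k U f -> Ck_on k U g -> Ck_on k U (f + g).
Proof.
move=> oU; elim: k f g => [|k IH] f g /=.
  by move=> cf cg p Up; apply: cvgD; [exact: cf|exact: cg].
move=> [df Df] [dg Dg]; split=> [p Up|v].
  by apply: differentiableD; [exact: df|exact: dg].
apply: (@eq_Ck_on _ _ _ ((fun p => 'D_v f p) + (fun p => 'D_v g p)));
  [by []| |exact: IH].
move=> p /set_mem Up; rewrite deriveD //; apply: diff_derivable;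
  [exact: df|exact: dg].
Qed.

(** Induction through the Leibniz rule, where [f] and [g] reappear undifferentiated; [Ck_onS] lowers
    their order to fit the induction hypothesis. *)
Lemma Ck_onM k U (f g : V -> R) : open U ->
  Ck_on k U f -> Ck_on k U g -> Ck_on k U (f * g).
Proof.
move=> oU; elim: k f g => [|k IH] f g.
  by move=> cf cg p Up; apply: cvgM; [exact: cf|exact: cg].
move=> Sf Sg; have [[df Df] [dg Dg]] := (Sf, Sg); split=> [p Up|v].
  by apply: differentiableM; [exact: df|exact: dg].
apply: (@eq_Ck_on _ _ _ (f * (fun p => 'D_v g p) + g * (fun p => 'D_v f p))).
- by [].
- move=> p /set_mem Up; rewrite deriveM //; apply: diff_derivable;
    [exact: df|exact: dg].
- by apply: Ck_onD => //; apply: IH => //;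
    [exact: Ck_onS Sf|exact: Dg|exact: Ck_onS Sg|exact: Df].
Qed.

(** The derivative of the inverse is minus the derivative of [f] times the squared inverse, so the
    induction hypothesis applies to the inverse itself. *)
Lemma Ck_onV k U (f : V -> R) : open U -> (forall p, U p -> f p != 0) ->
  Ck_on k U f -> Ck_on k U (fun p => (f p)^-1).
Proof.
move=> oU f0; elim: k => [|k IH].
  by move=> cf p Up; apply: cvgV; [exact: f0|exact: cf].
move=> Sf; have [df Df] := Sf; split=> [p Up|v].
  by apply: differentiableV; [exact: df|exact: f0].
have SV := IH (Ck_onS Sf).
apply: (@eq_Ck_on _ _ _
  (cst (-1) * ((fun p => (f p)^-1) * (fun p => (f p)^-1) *
    (fun p => 'D_v f p)))).
- by [].
- move=> p /set_mem Up; rewrite deriveV ?f0 //; last exact/diff_derivable/df.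
  by rewrite !fctE mulN1r expr2 invfM scaleNr.
- apply: Ck_onM; [by []|exact: Ck_on_cst|].
  by apply: Ck_onM; [by []|exact: Ck_onM|exact: Df].
Qed.

End Smooth.

(** * Topology of the extended line and of the configuration space *)

Section Topology.
Variable R : realType.

Lemma hausdorff_prod (T U : topologicalType) :
  hausdorff_space T -> hausdorff_space U -> hausdorff_space (T * U)%type.
Proof.
move=> hT hU [a b] [a' b'] cl; congr pair.
  apply: hT => A B nA nB.
  have [] := cl (fst @^-1` A) (fst @^-1` B);
    [exact: cvg_fst nA|exact: cvg_fst nB|].
  by move=> p []; exists p.1.
apply: hU => A B nA nB.
have [] := cl (snd @^-1` A) (snd @^-1` B);
  [exact: cvg_snd nA|exact: cvg_snd nB|].
by move=> p []; exists p.2.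
Qed.

Lemma hausdorff_config : hausdorff_space (config R).
Proof.
have h : hausdorff_space (extline R).
  by apply: one_point_compactification_hausdorff;
    [exact: locally_compactR|exact: Rhausdorff].
by do !apply: hausdorff_prod.
Qed.

Lemma pair_continuous (S T U : topologicalType) (f : S -> T) (g : S -> U) :
  continuous f -> continuous g -> continuous (fun x => (f x, g x)).
Proof. by move=> cf cg x; apply: cvg_pair; [exact: cf|exact: cg]. Qed.

Lemma comp_continuous (S T U : topologicalType) (f : S -> T) (g : T -> U) :
  continuous g -> continuous f -> continuous (g \o f).
Proof. by move=> cg cf x; apply: continuous_comp; [exact: cf|exact: cg]. Qed.

Lemma fst_continuous (S T : topologicalType) : continuous (@fst S T).
Proof. by move=> p; exact: cvg_fst. Qed.

Lemma snd_continuous (S T : topologicalType) : continuous (@snd S T).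
Proof. by move=> p; exact: cvg_snd. Qed.

Lemma fin_dense (t : extline R) (A : set (extline R)) :
  nbhs t A -> exists u, A (fin u).
Proof.
case: t => [u|] nA; first by exists u; exact: (nbhs_singleton nA).
case: nA => K [cK _] KA.
have [M [_ KM]] := compact_bounded cK.
(* The compact set [K] is bounded by [|M| + 1], so this point lies outside it. *)
pose u := `|M| + 2; exists u; apply: KA; left; exists u => // Ku.
have lt : M < `|M| + 1 by rewrite (le_lt_trans (ler_norm M)) // ltrDl.
have := KM _ lt _ Ku; rewrite /= /u ger0_norm ?addr_ge0 // lerD2l.
by rewrite leNgt ltr1n.
Qed.

(** At [infty], the complement of a compact set [K] pulls back to the complement of its rescaling by
    [c^-1], again compact. *)
Lemma oscale_continuous (c : R) : c != 0 -> continuous (@oscale R c).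
Proof.
move=> c0 [u|] A.
  move=> nA; have /(_ _ nA) : (fun v : R => c * v) @ u --> c * u.
    exact: mulrl_continuous.
  by [].
case=> K [cK clK] KA; pose L := [set c^-1 * v | v in K].
have cL : compact L.
  apply: continuous_compact cK; apply: continuous_subspaceT;
    exact: mulrl_continuous.
exists L; first by split=> //; exact: (compact_closed (@Rhausdorff R)).
move=> t [[u Lu <-]|->] /=; apply: KA; last by right.
by left; exists (c * u) => // Ku; apply: Lu;
  exists (c * u) => //; rewrite mulKf.
Qed.

(** The image of the compact extended line is closed in a Hausdorff space, and the density of the
    finite parameters makes every point a limit of finite configurations. *)
Lemma completed_curve (phi : extline R -> config R) : continuous phi ->
  (forall u, finite_configs (phi (fin u))) ->
  completed [set c | exists t, c = phi t].
Proof.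
move=> cphi fphi; rewrite /completed; set C := [set c | _].
have clC : closed C.
  apply: compact_closed; first exact: hausdorff_config.
  have -> : C = phi @` setT.
    by apply/seteqP; split=> [_ [t ->]|_ [t _ <-]]; exists t.
  apply: continuous_compact; first exact: continuous_subspaceT.
  exact: one_point_compactification_compact.
apply/seteqP; split=> [_ [t ->] A nA|].
  have [u Au] := fin_dense (cphi t A nA).
  by exists (phi (fin u)); split=> //; split; [exists (fin u)|].
by rewrite [X in _ `<=` X](iffLR (closure_id C) clC); apply: closureS => c [].
Qed.

End Topology.

(** * The unit circle as smooth model of the extended line *)

Section Circle.
Variable R : realType.

Lemma circle_point_surj (p : R * R) : circle p -> exists t, circle_point t = p.
Proof.
case: p => X S; rewrite /circle /= => XS.
have [X1|X1] := eqVneq X (-1).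
  exists infty => /=; rewrite X1; congr pair; apply/esym/eqP.
  rewrite -sqrf_eq0; apply/eqP; move: XS; rewrite X1; lra.
have d0 : 1 + X != 0 by rewrite addrC -[1]opprK subr_eq0.
have S2 : S ^+ 2 = (1 - X) * (1 + X) by rewrite -[LHS](addKr (X ^+ 2)) XS; ring.
(* The preimage [S / (1 + X)] is the stereographic projection from [(-1, 0)], that is, the
   half-angle tangent. *)
have e : 1 + (S / (1 + X)) ^+ 2 = 2 / (1 + X) by rewrite expr_div_n S2; field.
exists (fin (S / (1 + X))); rewrite /circle_point /fin e expr_div_n S2.
by congr pair; field.
Qed.

(* Scaling [tan (rho / 2)] by [c], in the coordinates [(cos rho, sin rho)]. *)
Definition circle_scale (c : R) (p : R * R) : R * R :=
  let d := (1 - c ^+ 2) * p.1 + (1 + c ^+ 2) in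
  (((1 + c ^+ 2) * p.1 + (1 - c ^+ 2)) / d, 2 * c * p.2 / d).

(** The denominator equals [(1 + X) + c ^+ 2 * (1 - X)]; on the circle both summands are
    nonnegative, and they vanish at opposite points. *)
Lemma circle_scale_den_gt0 (c : R) (p : R * R) : c != 0 -> circle p ->
  0 < (1 - c ^+ 2) * p.1 + (1 + c ^+ 2).
Proof.
move=> c0; case: p => X S; rewrite /circle /= => XS.
have c2 : 0 < c ^+ 2 by rewrite exprn_even_gt0.
have S2 := sqr_ge0 S.
have Xm : -1 <= X by nra.
have X1 : X <= 1 by nra.
have -> : (1 - c ^+ 2) * X + (1 + c ^+ 2) = (1 + X) + c ^+ 2 * (1 - X) by ring.
case: (lerP X 0) => X0.
  have : 0 < c ^+ 2 * (1 - X) by apply: mulr_gt0 => //; lra.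
  by move: Xm; lra.
have : 0 <= c ^+ 2 * (1 - X) by apply: mulr_ge0; [exact: ltW|lra].
by move: Xm; lra.
Qed.

Lemma circle_scaleE (c : R) (t : extline R) : c != 0 ->
  circle_scale c (circle_point t) = circle_point (oscale c t).
Proof.
move=> c0; case: t => [u|]; rewrite /circle_scale /=; last first.
  have -> : (1 - c ^+ 2) * -1 + (1 + c ^+ 2) = 2 * c ^+ 2 by ring.
  by congr pair; field.
have u0 := sqrD1_neq0 u; have cu0 := sqrD1_neq0 (c * u).
have e : (1 - c ^+ 2) * ((1 - u ^+ 2) / (1 + u ^+ 2)) + (1 + c ^+ 2) =
   2 * (1 + (c * u) ^+ 2) / (1 + u ^+ 2) by field.
by rewrite e; congr pair; field; rewrite u0 cu0.
Qed.

Lemma circle_scale_smooth (c : R) (U : set (R * R)) : open U ->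
  (forall p, U p -> (1 - c ^+ 2) * p.1 + (1 + c ^+ 2) != 0) ->
  smooth_on U (circle_scale c).
Proof.
move=> oU d0 k.
have S1 : Ck_on k U (fst : R * R -> R).
  by apply: Ck_on_linear => p; exact: cvg_fst.
have S2 : Ck_on k U (snd : R * R -> R).
  by apply: Ck_on_linear => p; exact: cvg_snd.
have Sc (a : R) : Ck_on k U (cst a : R * R -> R) by exact: Ck_on_cst.
have Sd : Ck_on k U (fun p : R * R => ((1 - c ^+ 2) * p.1 + (1 + c ^+ 2))^-1).
  apply: Ck_onV => //.
  exact: (Ck_onD oU (Ck_onM oU (Sc (1 - c ^+ 2)) S1) (Sc (1 + c ^+ 2))).
have Snum : Ck_on k U (fun p : R * R => (1 + c ^+ 2) * p.1 + (1 - c ^+ 2)).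
  exact: (Ck_onD oU (Ck_onM oU (Sc (1 + c ^+ 2)) S1) (Sc (1 - c ^+ 2))).
have Ssin : Ck_on k U (fun p : R * R => 2 * c * p.2).
  exact: (Ck_onM oU (Sc (2 * c)) S2).
exact: Ck_on_pair oU (Ck_onM oU Snum Sd) (Ck_onM oU Ssin Sd).
Qed.

(** The chart [pr] is linear, hence smooth everywhere. Its inverse [g] is required to be smooth only
    on a neighbourhood [U] of the circle, which leaves room for poles elsewhere in the plane. *)
Lemma diffeomorphic_to_circle_curve (phi : extline R -> config R)
  (pr : {linear ((R * R) * (R * R) * (R * R) * (R * R))%type -> (R * R)%type})
  (g : R * R -> (R * R) * (R * R) * (R * R) * (R * R)) (U : set (R * R)) :
  continuous pr -> open U -> circle `<=` U -> smooth_on U g ->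
  (forall t, pr (torus_point (phi t)) = circle_point t) ->
  (forall t, g (circle_point t) = torus_point (phi t)) ->
  diffeomorphic_to_circle [set c | exists t, c = phi t].
Proof.
move=> cpr oU cU sg prE gE; exists pr, g; split.
- move=> p _; exists setT, pr; split=> //; first exact: openT.
  by move=> k; exact: Ck_on_linear.
- by move=> p /cU Up; exists U, g.
- by move=> _ [_ [t ->] <-]; rewrite prE gE; split=> //;
    exact: circle_point_in_circle.
- move=> _ /circle_point_surj [t <-]; rewrite gE prE; split=> //.
  by exists (phi t) => //; exists t.
Qed.

End Circle.

(** * The three branches for a Miura sector angle *)

Section Miura.
Variables (R : realType) (a : R).
Hypothesis (a_range : 0 < a < pi) (a_neq : a <> pi / 2).

Let cs : cos a ^+ 2 + sin a ^+ 2 = 1.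
Proof. exact: cos2Dsin2. Qed.

Lemma sin_sector_neq0 : sin a != 0.
Proof. by rewrite gt_eqF // sin_gt0_pi. Qed.

Lemma cos_sector_neq0 : cos a != 0.
Proof.
(* The cosine is injective on [[0, pi]], so its only zero there is [pi / 2]. *)
apply/eqP => c0; apply: a_neq; apply: cos_inj; rewrite ?cos_pihalf //.
- by rewrite in_itv /= !ltW //; case/andP: a_range.
- have := pi_gt0 R; rewrite in_itv /=; lra.
Qed.

Definition flat_branch (t : extline R) : config R := (fin 0, t, fin 0, t).
Definition folded_branch (t : extline R) : config R :=
  (t, oscale (cos a) t, t, oscale (- cos a) t).
Definition infinite_branch (t : extline R) : config R :=
  (t, infty, oscale (-1) t, infty).

Lemma solutions_miura :
  solutions a (pi - a) (pi - a) a =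
  [set c | exists t, c = flat_branch t]
  `|` [set c | exists t, c = folded_branch t]
  `|` [set c | exists t, c = infinite_branch t].
Proof.
apply/seteqP; split=> [[[[x y] z] w]|].
  move/solutions_miuraE/(vertex3_solutions cs cos_sector_neq0 sin_sector_neq0).
  by case=> [] [-> -> ->];
    [left; left; exists y|left; right; exists x|right; exists x].
move=> _ [[] [t ->]|[t ->]]; apply/solutions_miuraE.
- exact: vertex3_flat.
- exact: vertex3_folded.
- exact: vertex3_infty.
Qed.

Lemma finite_infinite_branch t : ~ finite_configs (infinite_branch t).
Proof. by move=> [x [y [z [w]]]]. Qed.

(** The flat and folded branches each have one point at infinity, and both points lie on the
    infinite branch, at the parameters [fin 0] and [infty]. *)
Lemma infinite_solutions_miura :
  solutions_at_infinity a (pi - a) (pi - a) a =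
  [set c | exists t, c = infinite_branch t].
Proof.
rewrite /solutions_at_infinity solutions_miura; apply/seteqP; split.
  move=> _ [[[] [[t|] ->]|[t ->]] nfin].
  - by case: nfin; exists 0, t, 0, t.
  - by exists (fin 0); rewrite /infinite_branch /= mulr0.
  - by case: nfin; exists t, (cos a * t), t, (- cos a * t).
  - by exists infty.
  - by exists t.
by move=> _ [t ->]; split; [right; exists t|exact: finite_infinite_branch].
Qed.

Lemma finite_solutions_miura :
  finite_solutions a (pi - a) (pi - a) a =
  ([set c | exists t, c = flat_branch t]
   `|` [set c | exists t, c = folded_branch t])
  `&` finite_configs.
Proof.
rewrite /finite_solutions solutions_miura; apply/seteqP; split.
  move=> c [[//|[t ->]] /finite_infinite_branch //].
by move=> c [? ?]; split=> //; left.
Qed.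

Lemma completed_flat : completed [set c | exists t, c = flat_branch t].
Proof.
apply: completed_curve => [|u]; last by exists 0, u, 0, u.
have cc : continuous (fun _ : extline R => fin 0 : extline R).
  by move=> t; exact: cst_continuous.
have ci : continuous (id : extline R -> extline R) by move=> t A.
exact (pair_continuous (pair_continuous (pair_continuous cc ci) cc) ci).
Qed.

Lemma completed_folded : completed [set c | exists t, c = folded_branch t].
Proof.
have c0 := cos_sector_neq0; have c0N : - cos a != 0 by rewrite oppr_eq0.
apply: completed_curve => [|u].
  have ci : continuous (id : extline R -> extline R) by move=> t A.
  exact (pair_continuous (pair_continuous (pair_continuous ci
    (oscale_continuous c0)) ci) (oscale_continuous c0N)).
by exists u, (cos a * u), u, (- cos a * u).
Qed.

Lemma circle_flat :
  diffeomorphic_to_circle [set c | exists t, c = flat_branch t].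
Proof.
(* The projection selects [y], since [x] is constant on this branch. *)
apply: (@diffeomorphic_to_circle_curve R flat_branch
  (snd \o fst \o fst) (fun q => ((1, 0), q, (1, 0), q)) setT).
- exact: (comp_continuous (comp_continuous (@snd_continuous _ _)
    (@fst_continuous _ _)) (@fst_continuous _ _)).
- exact: openT.
- by [].
- move=> k; have Sid : Ck_on k setT (idfun : (R * R)%type -> (R * R)%type).
    by apply: Ck_on_linear => p.
  have Sc : Ck_on k setT (cst (1, 0) : (R * R)%type -> (R * R)%type).
    exact: Ck_on_cst.
  by do !apply: Ck_on_pair => //; exact: openT.
- by [].
- by move=> t; rewrite /= -circle_point_fin0.
Qed.

Lemma circle_folded :
  diffeomorphic_to_circle [set c | exists t, c = folded_branch t].
Proof.
have c0 := cos_sector_neq0; have c0N : - cos a != 0 by rewrite oppr_eq0.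
(* The scalings by [cos a] and [- cos a] share this denominator, which involves only the square of
   the factor; one open set [U] therefore serves both. *)
pose den (p : R * R) := (1 - cos a ^+ 2) * p.1 + (1 + cos a ^+ 2).
have cden : continuous den.
  move=> p; apply: cvgD; last exact: cvg_cst.
  by apply: cvgM; [exact: cvg_cst|exact: cvg_fst].
pose U := [set p | den p != 0].
have oU : open U.
  exact: (open_comp (fun p _ => cden p) (@open_neq R 0)).
apply: (@diffeomorphic_to_circle_curve R folded_branch (fst \o fst \o fst)
  (fun q => (q, circle_scale (cos a) q, q, circle_scale (- cos a) q)) U) => //.
- exact: (comp_continuous (comp_continuous (@fst_continuous _ _)
    (@fst_continuous _ _)) (@fst_continuous _ _)).
- by move=> p /(circle_scale_den_gt0 c0) /lt0r_neq0.
- move=> k; have Sid : Ck_on k U (idfun : (R * R)%type -> (R * R)%type).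
    by apply: Ck_on_linear => p.
  have S1 : Ck_on k U (circle_scale (cos a)) by exact: circle_scale_smooth.
  have S2 : Ck_on k U (circle_scale (- cos a)).
    by apply: circle_scale_smooth => // p; rewrite sqrrN.
  by do !apply: Ck_on_pair => //.
- by move=> t; rewrite !circle_scaleE.
Qed.

Lemma circle_infinite :
  diffeomorphic_to_circle [set c | exists t, c = infinite_branch t].
Proof.
apply: (@diffeomorphic_to_circle_curve R infinite_branch (fst \o fst \o fst)
  (fun q => (q, (-1, 0), circle_scale (-1) q, (-1, 0))) setT) => //.
- exact: (comp_continuous (comp_continuous (@fst_continuous _ _)
    (@fst_continuous _ _)) (@fst_continuous _ _)).
- exact: openT.
- move=> k; have Sid : Ck_on k setT (idfun : (R * R)%type -> (R * R)%type).
    by apply: Ck_on_linear => p.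
  have Sc : Ck_on k setT (cst (-1, 0) : (R * R)%type -> (R * R)%type).
    exact: Ck_on_cst.
  have S1 : Ck_on k setT (circle_scale (-1) : R * R -> R * R).
    (* For the factor [-1] the denominator is the constant 2, so the scaling is smooth on the whole
       plane. *)
    apply: circle_scale_smooth => [|p _]; first exact: openT.
    by rewrite sqrrN expr1n subrr mul0r add0r (pnatr_eq0 _ 2).
  by do !apply: Ck_on_pair => //; exact: openT.
- by move=> t; rewrite circle_scaleE // oppr_eq0 oner_eq0.
Qed.

End Miura.

Theorem mainTheorem5 (R : realType) (alpha beta gamma delta : R)
  (alpha_range : 0 < alpha < pi) (beta_range : 0 < beta < pi)
  (gamma_range : 0 < gamma < pi) (delta_range : 0 < delta < pi)
  (alpha_beta : alpha = pi - beta) (beta_gamma : pi - beta = pi - gamma)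
  (gamma_delta : pi - gamma = delta) (delta_neq : delta <> pi / 2) :
  let B1 : set (config R) :=
    [set c | exists y : extline R, c = (fin 0, y, fin 0, y)] in
  let B2 : set (config R) :=
    [set c | exists x : extline R,
       c = (x, oscale (cos alpha) x, x, oscale (- cos alpha) x)] in
  let B3 : set (config R) :=
    [set c | exists x : extline R, c = (x, infty, oscale (-1) x, infty)] in
  (finite_solutions alpha beta gamma delta
     = (B1 `|` B2) `&` finite_configs
   /\ (B1 `|` B2 `<=` solutions alpha beta gamma delta)
   /\ (completed B1 /\ completed B2)
   /\ (~ (B1 `<=` B2) /\ ~ (B2 `<=` B1))
   /\ (diffeomorphic_to_circle B1 /\ diffeomorphic_to_circle B2))
  /\
  (solutions_at_infinity alpha beta gamma delta = B3
   /\ ~ (B3 `<=` B1 `|` B2)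
   /\ diffeomorphic_to_circle B3).
Proof.
move=> B1 B2 B3.
have bE : beta = pi - alpha by rewrite alpha_beta subKr.
have gE : gamma = pi - alpha by rewrite alpha_beta beta_gamma subKr.
have dE : delta = alpha by rewrite -gamma_delta -beta_gamma.
have a_neq : alpha <> pi / 2 by rewrite -dE.
have one0 : fin 1 <> fin 0 :> extline R by case=> /eqP; rewrite oner_eq0.
rewrite bE gE dE; do !split.
- exact: finite_solutions_miura.
- by rewrite (solutions_miura alpha_range a_neq); exact: subsetUl.
- exact: completed_flat.
- exact: completed_folded.
(* On the folded branch [x = 0] forces [y = 0], which excludes the flat configuration with
   [y = 1]. *)
- move=> /(_ (flat_branch (fin 1))) [|x e]; first by exists (fin 1).
  have x0 : x = fin 0 := esym (congr1 (fun c => c.1.1.1) e).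
  have y1 : fin 1 = oscale (cos alpha) x := congr1 (fun c => c.1.1.2) e.
  by apply: one0; rewrite y1 x0 /= mulr0.
- move=> /(_ (folded_branch alpha (fin 1))) [|y e]; first by exists (fin 1).
  exact: one0 (congr1 (fun c => c.1.1.1) e).
- exact: circle_flat.
- exact: circle_folded.
- exact: infinite_solutions_miura.
(* The configuration with [x = 1] at infinity is not flat because [x] is nonzero, and not folded
   because a finite [x] would make [y] finite. *)
- move=> /(_ (infinite_branch (fin 1))) [|[y e]|[x e]]; first by exists (fin 1).
    exact: one0 (congr1 (fun c => c.1.1.1) e).
  have x1 : x = fin 1 := esym (congr1 (fun c => c.1.1.1) e).
  by have := congr1 (fun c => c.1.1.2) e; rewrite x1.
- exact: circle_infinite.
Qed.
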